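(* Let $T$ be a torus defined over a number field $K$, let $T_a$ be its maximal anisotropic subtorus and $T_d$ its maximal split subtorus, and suppose that the (finite) intersection $T_a\cap T_d$ is non-trivial. Let $R\in T_d(K)$ be an independent point. Let $$G=T\times T_d,\qquad P=(R,0),\qquad Q=(0,R).$$ Then for all but finitely many primes $\mathfrak p$ of $K$ the order of $(Q\bmod\mathfrak p)$ divides the order of $(P\bmod\mathfrak p)$, and the minimal positive integer $c$ such that $\phi(P)=cQ$ for some $\phi\in\mathrm{End}_K(G)$ is a multiple of the exponent of the group $(T_a\cap T_d)(\bar K)$. In particular $c\neq 1$, i.e. there is no $\phi\in\mathrm{End}_K(G)$ with $\phi(P)=Q$.
   Context: The group laws on tori are written additively, so $0$ is the neutral element. A point $R\in T_d(K)$, where $T_d\simeq\mathbb{G}_m^r$ over $K$, is independent if its coordinates are multiplicatively independent elements of $K^*$. $(\cdot\bmod\mathfrak p)$ denotes reduction modulo $\mathfrak p$, defined for all but finitely many primes $\mathfrak p$ of $K$. It is known that a positive integer $c$ with $\phi(P)=cQ$ for some $\phi \in \mathrm{End}_K(G)$ exists. *)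

(* Defs.v *)
From HB Require Import structures.
From mathcomp Require Import all_boot all_algebra all_field.
From mathcomp Require Import generic_quotient ring_quotient.
From mathcomp Require Import boolp classical_sets functions cardinality.

Set Implicit Arguments.
Unset Strict Implicit.
Unset Printing Implicit Defensive.

Import GRing.Theory.
Local Open Scope ring_scope.
Local Open Scope classical_set_scope.

(******************************************************************************)
(* Commutative affine group schemes are handled through their functors of     *)
(* points on commutative algebras.                                            *)
(******************************************************************************)

(* A commutative B-algebra is a commutative ring with a structure morphism    *)
(* from B (rather than a comAlgType B), so that restriction of scalars along  *)
(* a ring morphism is composition of structure morphisms.                     *)
Record alg (B : comPzRingType) := Alg {
  alg_ring :> comPzRingType;
  alg_str : {rmorphism B -> alg_ring} }.

Record algHom (B : comPzRingType) (A A' : alg B) := AlgHom {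
  algHom_fun :> {rmorphism A -> A'};
  algHom_str : forall b : B, algHom_fun (alg_str A b) = alg_str A' b }.

Lemma algHom_eq (B : comPzRingType) (A A' : alg B) (f g : algHom A A') :
  f =1 g -> f = g.
Proof.
case: f g => [[f [[f0] [f1]]] fs] [[g [[g0] [g1]]] gs] /= /funext fg.
move: fg g0 g1 gs => /= <- g0 g1 gs.
by rewrite (Prop_irrelevance g0 f0) (Prop_irrelevance g1 f1) in gs *;
  rewrite (Prop_irrelevance gs fs).
Qed.

Definition idHom (B : comPzRingType) (A : alg B) : algHom A A :=
  @AlgHom B A A idfun (fun=> erefl).

Lemma compHom_str (B : comPzRingType) (A1 A2 A3 : alg B)
    (g : algHom A2 A3) (f : algHom A1 A2) (b : B) :
  (g \o f) (alg_str A1 b) = alg_str A3 b.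
Proof. by rewrite /= !algHom_str. Qed.

Definition compHom (B : comPzRingType) (A1 A2 A3 : alg B)
    (g : algHom A2 A3) (f : algHom A1 A2) : algHom A1 A3 :=
  AlgHom (compHom_str g f).

Definition selfAlg (B : comPzRingType) : alg B := @Alg B B idfun.

Record groupFunctor (B : comPzRingType) := GroupFunctor {
  gf_pts :> alg B -> zmodType;
  gf_map : forall A A' : alg B, algHom A A' ->
    {additive gf_pts A -> gf_pts A'};
  gf_id : forall (A : alg B) (x : gf_pts A), gf_map (idHom A) x = x;
  gf_comp : forall (A1 A2 A3 : alg B) (g : algHom A2 A3) (f : algHom A1 A2)
    (x : gf_pts A1), gf_map (compHom g f) x = gf_map g (gf_map f x) }.

Record gfHom (B : comPzRingType) (G G' : groupFunctor B) := GfHom {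
  gfHom_fun :> forall A : alg B, {additive G A -> G' A};
  gfHom_nat : forall (A A' : alg B) (f : algHom A A') (x : G A),
    gfHom_fun A' (gf_map G f x) = gf_map G' f (gfHom_fun A x) }.

Definition gfIso (B : comPzRingType) (G G' : groupFunctor B)
    (f : gfHom G G') : Prop :=
  forall A : alg B, bijective (f A).

Definition isomorphic (B : comPzRingType) (G G' : groupFunctor B) : Prop :=
  exists f : gfHom G G', gfIso f.

Definition finitelyGenerated (B : comPzRingType) (H : alg B) : Prop :=
  exists s : seq H, forall E : {pred H}, GRing.subring_closed E ->
    (forall b : B, alg_str H b \in E) -> {subset s <= E} ->
    forall h : H, h \in E.

(* (H, u) represents G: u is the universal point, so that H is the coordinate *)
(* ring of G and f |-> gf_map G f u is the bijection Hom(H, A) -> G(A).       *)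
Definition represents (B : comPzRingType) (G : groupFunctor B)
    (H : alg B) (u : G H) : Prop :=
  forall (A : alg B) (x : G A), exists! f : algHom H A, gf_map G f u = x.

Definition affineFiniteType (B : comPzRingType) (G : groupFunctor B) : Prop :=
  exists (H : alg B) (u : G H), represents u /\ finitelyGenerated H.

Section BaseChange.
Variables (B B' : comPzRingType) (j : {rmorphism B -> B'}).

Definition restrAlg (A : alg B') : alg B := Alg (alg_str A \o j).

Lemma restrHom_str (A A' : alg B') (f : algHom A A') (b : B) :
  f (alg_str (restrAlg A) b) = alg_str (restrAlg A') b.
Proof. exact: algHom_str. Qed.

Definition restrHom (A A' : alg B') (f : algHom A A') :
    algHom (restrAlg A) (restrAlg A') :=
  @AlgHom B (restrAlg A) (restrAlg A') f (restrHom_str f).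

Variable G : groupFunctor B.

Lemma baseChange_id (A : alg B') (x : G (restrAlg A)) :
  gf_map G (restrHom (idHom A)) x = x.
Proof. by rewrite -[RHS]gf_id; congr (gf_map G _ x); exact: algHom_eq. Qed.

Lemma baseChange_comp (A1 A2 A3 : alg B') (g : algHom A2 A3)
    (f : algHom A1 A2) (x : G (restrAlg A1)) :
  gf_map G (restrHom (compHom g f)) x =
  gf_map G (restrHom g) (gf_map G (restrHom f) x).
Proof. by rewrite -gf_comp; congr (gf_map G _ x); exact: algHom_eq. Qed.

Definition baseChange : groupFunctor B' :=
  @GroupFunctor B' (fun A => G (restrAlg A)) (fun A A' f => gf_map G (restrHom f))
    baseChange_id baseChange_comp.

End BaseChange.

Section Product.
Variables (B : comPzRingType) (G G' : groupFunctor B).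

Definition prod_map (A A' : alg B) (f : algHom A A') (x : G A * G' A) :
    G A' * G' A' :=
  (gf_map G f x.1, gf_map G' f x.2).

Lemma prod_map_is_zmod_morphism (A A' : alg B) (f : algHom A A') :
  zmod_morphism (prod_map f).
Proof. by move=> x y; rewrite /prod_map !raddfB. Qed.

HB.instance Definition _ (A A' : alg B) (f : algHom A A') :=
  GRing.isZmodMorphism.Build _ _ (prod_map f) (prod_map_is_zmod_morphism f).

Lemma prod_map_id (A : alg B) (x : G A * G' A) : prod_map (idHom A) x = x.
Proof. by case: x => x y; rewrite /prod_map !gf_id. Qed.

Lemma prod_map_comp (A1 A2 A3 : alg B) (g : algHom A2 A3)
    (f : algHom A1 A2) (x : G A1 * G' A1) :
  prod_map (compHom g f) x = prod_map g (prod_map f x).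
Proof. by rewrite /prod_map !gf_comp. Qed.

Definition prodGF : groupFunctor B :=
  @GroupFunctor B (fun A => (G A * G' A)%type)
    (fun A A' f => prod_map f) prod_map_id prod_map_comp.

End Product.

Section Power.
Variables (B : comPzRingType) (G : groupFunctor B) (r : nat).

Definition pow_map (A A' : alg B) (f : algHom A A') (x : {ffun 'I_r -> G A}) :
    {ffun 'I_r -> G A'} :=
  [ffun i => gf_map G f (x i)].

Lemma pow_map_is_zmod_morphism (A A' : alg B) (f : algHom A A') :
  zmod_morphism (pow_map f).
Proof. by move=> x y; apply/ffunP => i; rewrite !ffunE raddfB. Qed.

HB.instance Definition _ (A A' : alg B) (f : algHom A A') :=
  GRing.isZmodMorphism.Build _ _ (pow_map f) (pow_map_is_zmod_morphism f).

Lemma pow_map_id (A : alg B) (x : {ffun 'I_r -> G A}) :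
  pow_map (idHom A) x = x.
Proof. by apply/ffunP => i; rewrite ffunE gf_id. Qed.

Lemma pow_map_comp (A1 A2 A3 : alg B) (g : algHom A2 A3)
    (f : algHom A1 A2) (x : {ffun 'I_r -> G A1}) :
  pow_map (compHom g f) x = pow_map g (pow_map f x).
Proof. by apply/ffunP => i; rewrite !ffunE gf_comp. Qed.

Definition powGF : groupFunctor B :=
  @GroupFunctor B (fun A => {ffun 'I_r -> G A})
    (fun A A' f => pow_map f) pow_map_id pow_map_comp.

End Power.

(* The group of units of A, written additively: pairs (x, y) with x * y = 1.  *)
Section Units.
Variable A : comPzRingType.

Definition gmPts := {x : A * A | x.1 * x.2 == 1}.
HB.instance Definition _ := Choice.on gmPts.

Definition gm_val (x : gmPts) : A := (val x).1.
Definition gm_inv (x : gmPts) : A := (val x).2.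

Lemma gm_valV (x : gmPts) : gm_val x * gm_inv x = 1.
Proof. exact/eqP/(valP x). Qed.

Lemma gm_inj : injective gm_val.
Proof.
move=> x y xy; apply: val_inj.
have iE : gm_inv x = gm_inv y.
  by rewrite -[LHS]mul1r -(gm_valV y) -xy mulrAC gm_valV mul1r.
by move: xy iE; rewrite /gm_val /gm_inv; case: (val x) (val y) => ? ? [? ?] /= -> ->.
Qed.

Lemma gm_zero_subproof : (1 : A, 1 : A).1 * (1 : A, 1 : A).2 == 1.
Proof. by rewrite /= mulr1. Qed.

Lemma gm_opp_subproof (x : gmPts) :
  (gm_inv x, gm_val x).1 * (gm_inv x, gm_val x).2 == 1.
Proof. by rewrite /= mulrC gm_valV. Qed.

Lemma gm_add_subproof (x y : gmPts) :
  (gm_val x * gm_val y, gm_inv x * gm_inv y).1 *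
  (gm_val x * gm_val y, gm_inv x * gm_inv y).2 == 1.
Proof. by rewrite /= mulrACA !gm_valV mulr1. Qed.

Definition gm_zero : gmPts := Sub (1, 1) gm_zero_subproof.
Definition gm_opp (x : gmPts) : gmPts := Sub (gm_inv x, gm_val x) (gm_opp_subproof x).
Definition gm_add (x y : gmPts) : gmPts :=
  Sub (gm_val x * gm_val y, gm_inv x * gm_inv y) (gm_add_subproof x y).

Lemma gm_addA : associative gm_add.
Proof. by move=> x y z; apply: gm_inj; rewrite /gm_val /= mulrA. Qed.
Lemma gm_addC : commutative gm_add.
Proof. by move=> x y; apply: gm_inj; rewrite /gm_val /= mulrC. Qed.
Lemma gm_add0 : left_id gm_zero gm_add.
Proof. by move=> x; apply: gm_inj; rewrite /gm_val /= mul1r. Qed.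
Lemma gm_addN : left_inverse gm_zero gm_opp gm_add.
Proof. by move=> x; apply: gm_inj; rewrite /gm_val /= mulrC gm_valV. Qed.

HB.instance Definition _ :=
  GRing.isZmodule.Build gmPts gm_addA gm_addC gm_add0 gm_addN.

End Units.

Section MultiplicativeGroup.
Variable B : comPzRingType.

Lemma gm_map_subproof (A A' : alg B) (f : algHom A A') (x : gmPts A) :
  (f (gm_val x), f (gm_inv x)).1 * (f (gm_val x), f (gm_inv x)).2 == 1.
Proof. by rewrite /= -rmorphM gm_valV rmorph1. Qed.

Definition gm_map (A A' : alg B) (f : algHom A A') (x : gmPts A) : gmPts A' :=
  Sub (f (gm_val x), f (gm_inv x)) (gm_map_subproof f x).

Lemma gm_map_is_zmod_morphism (A A' : alg B) (f : algHom A A') :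
  zmod_morphism (gm_map f).
Proof. by move=> x y; apply: gm_inj; rewrite /gm_val /= rmorphM. Qed.

HB.instance Definition _ (A A' : alg B) (f : algHom A A') :=
  GRing.isZmodMorphism.Build _ _ (gm_map f) (gm_map_is_zmod_morphism f).

Lemma gm_map_id (A : alg B) (x : gmPts A) : gm_map (idHom A) x = x.
Proof. exact: gm_inj. Qed.

Lemma gm_map_comp (A1 A2 A3 : alg B) (g : algHom A2 A3)
    (f : algHom A1 A2) (x : gmPts A1) :
  gm_map (compHom g f) x = gm_map g (gm_map f x).
Proof. exact: gm_inj. Qed.

Definition Gm : groupFunctor B :=
  @GroupFunctor B (fun A => gmPts A) (fun A A' f => gm_map f)
    gm_map_id gm_map_comp.

End MultiplicativeGroup.

Record subGF (B : comPzRingType) (G : groupFunctor B) := SubGF {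
  subGF_car :> forall A : alg B, {pred G A};
  subGF_closed : forall A : alg B, zmod_closed (@subGF_car A);
  subGF_map : forall (A A' : alg B) (f : algHom A A') (x : G A),
    x \in @subGF_car A -> gf_map G f x \in @subGF_car A' }.

Section SubFunctor.
Variables (B : comPzRingType) (G : groupFunctor B) (S : subGF G).

Definition subPts (A : alg B) := {x : G A | x \in S A}.
HB.instance Definition _ (A : alg B) := SubChoice.on (subPts A).
HB.instance Definition _ (A : alg B) :=
  GRing.SubChoice_isSubZmodule.Build (G A) _ (subPts A) (subGF_closed S A).

Lemma sub_map_subproof (A A' : alg B) (f : algHom A A') (x : subPts A) :
  gf_map G f (val x) \in S A'.
Proof. exact/subGF_map/(valP x). Qed.

Definition sub_map (A A' : alg B) (f : algHom A A') (x : subPts A) :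
    subPts A' :=
  Sub (gf_map G f (val x)) (sub_map_subproof f x).

Lemma sub_map_is_zmod_morphism (A A' : alg B) (f : algHom A A') :
  zmod_morphism (sub_map f).
Proof. by move=> x y; apply: val_inj; rewrite /= !raddfB. Qed.

HB.instance Definition _ (A A' : alg B) (f : algHom A A') :=
  GRing.isZmodMorphism.Build _ _ (sub_map f) (sub_map_is_zmod_morphism f).

Lemma sub_map_id (A : alg B) (x : subPts A) : sub_map (idHom A) x = x.
Proof. by apply: val_inj; rewrite /= gf_id. Qed.

Lemma sub_map_comp (A1 A2 A3 : alg B) (g : algHom A2 A3)
    (f : algHom A1 A2) (x : subPts A1) :
  sub_map (compHom g f) x = sub_map g (sub_map f x).
Proof. by apply: val_inj; rewrite /= gf_comp. Qed.

Definition subFunctor : groupFunctor B :=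
  @GroupFunctor B subPts (fun A A' f => sub_map f) sub_map_id sub_map_comp.

End SubFunctor.

Coercion subFunctor : subGF >-> groupFunctor.

(* S is cut out in G by a set I of elements of the coordinate ring of G.      *)
Definition closedSub (B : comPzRingType) (G : groupFunctor B) (S : subGF G) :
    Prop :=
  exists (H : alg B) (u : G H), represents u /\
    exists I : {pred H}, forall (A : alg B) (f : algHom H A),
      gf_map G f u \in S A <-> {in I, forall h : H, f h = 0}.

Definition subGF_le (B : comPzRingType) (G : groupFunctor B) (S S' : subGF G) :
    Prop :=
  forall A : alg B, {subset S A <= S' A}.

Definition maximalSub (B : comPzRingType) (G : groupFunctor B)
    (P : subGF G -> Prop) (S : subGF G) : Prop :=
  P S /\ forall S' : subGF G, P S' -> subGF_le S S' -> subGF_le S' S.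

Definition interGF (B : comPzRingType) (G : groupFunctor B) (S S' : subGF G)
    (A : alg B) : {pred G A} :=
  [predI S A & S' A].
Arguments interGF {B G} S S' A.

(******************************************************************************)
(* Tori over a field K; L is meant to be an algebraic closure of K.           *)
(******************************************************************************)

Definition isAlgClosure (K : fieldType) (L : closedFieldType)
    (iota : {rmorphism K -> L}) : Prop :=
  forall x : L, algebraicOver iota x.

Definition isTorus (K : fieldType) (L : closedFieldType)
    (iota : {rmorphism K -> L}) (T : groupFunctor K) : Prop :=
  affineFiniteType T /\
  exists r : nat, isomorphic (baseChange iota T) (powGF (Gm L) r).

Definition isSplit (K : fieldType) (T : groupFunctor K) : Prop :=
  exists r : nat, isomorphic T (powGF (Gm K) r).

(* No non-trivial character defined over K. *)
Definition isAnisotropic (K : fieldType) (T : groupFunctor K) : Prop :=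
  forall (chi : gfHom T (Gm K)) (A : alg K) (x : T A), chi A x = 0.

Definition isSubtorus (K : fieldType) (L : closedFieldType)
    (iota : {rmorphism K -> L}) (T : groupFunctor K) (S : subGF T) : Prop :=
  closedSub S /\ isTorus iota S.

Definition isMaxAnisotropic (K : fieldType) (L : closedFieldType)
    (iota : {rmorphism K -> L}) (T : groupFunctor K) : subGF T -> Prop :=
  maximalSub (fun S => isSubtorus iota S /\ isAnisotropic S).

Definition isMaxSplit (K : fieldType) (L : closedFieldType)
    (iota : {rmorphism K -> L}) (T : groupFunctor K) : subGF T -> Prop :=
  maximalSub (fun S => isSubtorus iota S /\ isSplit S).

Definition independent (K : fieldType) (T : groupFunctor K)
    (R : T (selfAlg K)) : Prop :=
  exists (r : nat) (f : gfHom T (powGF (Gm K) r)), gfIso f /\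
    forall n : 'I_r -> int,
      \prod_(i < r) (gm_val (f (selfAlg K) R i) : K) ^ n i = 1 ->
      forall i, n i = 0.

(******************************************************************************)
(* Orders and exponents                                                       *)
(******************************************************************************)

(* As n = 0 when x has infinite order, every x has exactly one order.         *)
Definition isOrder (V : zmodType) (x : V) (n : nat) : Prop :=
  forall k : nat, x *+ k = 0 <-> (n %| k)%N.

Definition isMinPos (P : nat -> Prop) (n : nat) : Prop :=
  [/\ (0 < n)%N, P n & forall k : nat, (0 < k)%N -> P k -> (n <= k)%N].

Definition isExponent (V : zmodType) (W : {pred V}) : nat -> Prop :=
  isMinPos (fun n => {in W, forall x : V, x *+ n = 0}).

(******************************************************************************)
(* Reduction modulo primes of a number field K                                *)
(******************************************************************************)

Section NumberField.
Variable K : fieldExtType rat.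

Definition ringOfIntegers_pred : {pred K} :=
  fun x => `[< integralOver (intr : int -> K) x >].

Lemma ringOfIntegers_closed : GRing.subring_closed ringOfIntegers_pred.
Proof.
split=> [|x y|x y].
- exact/asboolP/integral1.
- by move=> /asboolP xO /asboolP yO; apply/asboolP/integral_sub.
- by move=> /asboolP xO /asboolP yO; apply/asboolP/integral_mul.
Qed.

Definition ringOfIntegers := {x : K | x \in ringOfIntegers_pred}.
HB.instance Definition _ := SubChoice.on ringOfIntegers.
HB.instance Definition _ :=
  GRing.SubChoice_isSubComNzRing.Build K _ ringOfIntegers ringOfIntegers_closed.

(* Nonzero prime ideals; idealr_closed includes properness. The field is not  *)
(* typed {pred _}, whose universe is too large for sets of primes.            *)
Record primeOf := PrimeOf {
  prime_set : ringOfIntegers -> bool;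
  prime_ideal : idealr_closed prime_set;
  prime_prime : prime_idealr_closed prime_set;
  prime_neq0 : exists2 a, a \in prime_set & a != 0 }.

Section Localization.
Variable p : primeOf.

Definition localRing_pred : {pred K} := fun x =>
  `[< exists a b : ringOfIntegers, b \notin prime_set p /\ x = val a / val b >].

Lemma prime_notinM (a b : ringOfIntegers) :
  a \notin prime_set p -> b \notin prime_set p -> a * b \notin prime_set p.
Proof.
by move=> ap bp; apply/negP => /(prime_prime (p := p)); rewrite (negPf ap) (negPf bp).
Qed.

Lemma prime_notin1 : 1 \notin prime_set p.
Proof. by case: (prime_ideal p). Qed.

Lemma prime_mem0 : 0 \in prime_set p.
Proof. by case: (prime_ideal p). Qed.

Lemma prime_memB (a b : ringOfIntegers) :
  a \in prime_set p -> b \in prime_set p -> a - b \in prime_set p.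
Proof.
by move=> ap bp; case: (prime_ideal p) => _ _ pB; rewrite addrC -mulN1r; exact: pB.
Qed.

Lemma prime_memMl (a b : ringOfIntegers) :
  b \in prime_set p -> a * b \in prime_set p.
Proof.
by move=> bp; case: (prime_ideal p) => p0 _ pM; rewrite -[_ * _]addr0; exact: pM.
Qed.

Lemma notin_neq0 (b : ringOfIntegers) :
  b \notin prime_set p -> val b != 0.
Proof.
by apply: contraNneq => b0; rewrite (_ : b = 0) ?prime_mem0//; exact: val_inj.
Qed.

Lemma localRing_closed : GRing.subring_closed localRing_pred.
Proof.
split=> [|x y /asboolP[a [b [bp ->]]] /asboolP[c [d [dp ->]]]
         |x y /asboolP[a [b [bp ->]]] /asboolP[c [d [dp ->]]]]; apply/asboolP.
- by exists 1, 1; split; [exact: prime_notin1|rewrite rmorph1 divr1].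
- exists (a * d - c * b), (b * d); split; first exact: prime_notinM.
  by rewrite rmorphB !rmorphM -[- (_ / _)]mulNr addf_div ?notin_neq0// mulNr.
- exists (a * c), (b * d); split; first exact: prime_notinM.
  by rewrite !rmorphM mulf_div.
Qed.

Definition localRing := {x : K | x \in localRing_pred}.
HB.instance Definition _ := SubChoice.on localRing.
HB.instance Definition _ :=
  GRing.SubChoice_isSubComNzRing.Build K _ localRing localRing_closed.

Definition localIdeal : {pred localRing} := fun x =>
  `[< exists a b : ringOfIntegers, [/\ a \in prime_set p,
        b \notin prime_set p & val x = val a / val b] >].

Lemma localIdeal_closed : idealr_closed localIdeal.
Proof.
split.
- apply/asboolP; exists 0, 1.
  by rewrite prime_mem0 prime_notin1 !rmorph0 mul0r.
- apply/negP => /asboolP[a [b [ap bp]]]; rewrite rmorph1 => ab.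
  have /eqP := ab; rewrite eq_sym -(inj_eq (mulIf (notin_neq0 bp))).
  rewrite divfK ?notin_neq0// mul1r => /eqP/val_inj abE.
  by move: bp; rewrite -abE ap.
- move=> x u v /asboolP[a [b [ap bp uE]]] /asboolP[c [d [cp dp vE]]].
  have /asboolP[e [f [fp xE]]] := valP x.
  apply/asboolP; exists (e * a * d - - (c * (f * b))), (f * b * d).
  split; last by rewrite opprK rmorphD !rmorphM /= uE vE xE mulf_div
    addf_div ?notin_neq0 ?prime_notinM// mulf_neq0// ?notin_neq0.
  + apply: prime_memB; first by rewrite mulrAC mulrC mulrCA prime_memMl// mulrC prime_memMl.
    by rewrite -mulrN mulrC prime_memMl.
  + by rewrite !prime_notinM.
Qed.

HB.instance Definition _ :=
  isIdealr.Build localRing localIdeal localIdeal_closed.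

(* The local ring modulo its maximal ideal, isomorphic to O_K / p. *)
Definition residueRing := {ideal_quot localIdeal}.

End Localization.

Section SIntegers.
Variable S : set primeOf.

Definition sIntegers_pred : {pred K} :=
  fun x => `[< forall p : primeOf, ~ S p -> x \in localRing_pred p >].


Lemma sIntegers_closed : GRing.subring_closed sIntegers_pred.
Proof.
split=> [|x y /asboolP xS /asboolP yS|x y /asboolP xS /asboolP yS];
  apply/asboolP => p Sp; have [l1 lB lM] := localRing_closed p.
- exact: l1.
- by apply: lB; [exact: xS|exact: yS].
- by apply: lM; [exact: xS|exact: yS].
Qed.

(* The ring of elements of K that are integral at all primes outside S. *)
Definition sIntegers := {x : K | x \in sIntegers_pred}.
HB.instance Definition _ := SubChoice.on sIntegers.
HB.instance Definition _ :=
  GRing.SubChoice_isSubComNzRing.Build K _ sIntegers sIntegers_closed.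

Definition sIntegers_inj : {rmorphism sIntegers -> K} :=
  (val : sIntegers -> K).

Section OutsideS.
Variables (p : primeOf) (Sp : ~ S p).

Lemma sIntegers_local_subproof (x : sIntegers) : val x \in localRing_pred p.
Proof. by have /asboolP := valP x; exact. Qed.

Definition sIntegers_local_fun (x : sIntegers) : localRing p :=
  Sub (val x) (sIntegers_local_subproof x).

Lemma sIntegers_local_is_zmod_morphism : zmod_morphism sIntegers_local_fun.
Proof. by move=> x y; apply: val_inj; exact: rmorphB. Qed.

Lemma sIntegers_local_is_monoid_morphism :
  monoid_morphism sIntegers_local_fun.
Proof. by split=> [|x y]; apply: val_inj; rewrite /= ?rmorph1 ?rmorphM. Qed.

HB.instance Definition _ := GRing.isZmodMorphism.Build _ _
  sIntegers_local_fun sIntegers_local_is_zmod_morphism.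
HB.instance Definition _ := GRing.isMonoidMorphism.Build _ _
  sIntegers_local_fun sIntegers_local_is_monoid_morphism.

Definition sIntegers_local : {rmorphism sIntegers -> localRing p} :=
  sIntegers_local_fun.

Definition residue_pi : {rmorphism localRing p -> residueRing p} :=
  \pi_(residueRing p)%qT.

Definition localRing_inj : {rmorphism localRing p -> K} :=
  (val : localRing p -> K).

(* The local ring, the residue ring and K as algebras over the S-integers.    *)
Definition localAlg : alg sIntegers := Alg sIntegers_local.
Definition residueAlg : alg sIntegers := Alg (residue_pi \o sIntegers_local).
Definition fracAlg : alg sIntegers := restrAlg sIntegers_inj (selfAlg K).

Definition localToFrac : algHom localAlg fracAlg :=
  @AlgHom _ localAlg fracAlg localRing_inj (fun=> erefl).

Definition localToResidue : algHom localAlg residueAlg :=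
  @AlgHom _ localAlg residueAlg residue_pi (fun=> erefl).

End OutsideS.

(* A model over the S-integers of a group functor over K.                     *)
Record model (G : groupFunctor K) := Model {
  model_gf :> groupFunctor sIntegers;
  model_affine : affineFiniteType model_gf;
  model_generic : gfHom (baseChange sIntegers_inj model_gf) G;
  model_genericP : gfIso model_generic }.

(* x is (P mod p): P extends to a point of the model over the local ring at   *)
(* p, whose image over the residue field is x.                                *)
Definition reducesTo (G : groupFunctor K) (M : model G) (p : primeOf)
    (Sp : ~ S p) (P : G (selfAlg K)) (x : M (residueAlg Sp)) : Prop :=
  exists Pt : M (localAlg Sp),
    model_generic M (selfAlg K) (gf_map M (localToFrac Sp) Pt) = P /\
    gf_map M (localToResidue Sp) Pt = x.

(* (P mod p) and (Q mod p) are defined, and the order of the latter divides   *)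
(* the order of the former.                                                   *)
Definition orderModDvd (G : groupFunctor K) (M : model G)
    (Q P : G (selfAlg K)) (p : primeOf) : Prop :=
  exists (Sp : ~ S p) (x y : M (residueAlg Sp)) (m n : nat),
    [/\ reducesTo P x, reducesTo Q y, isOrder x m, isOrder y n & (n %| m)%N].

End SIntegers.
End NumberField.

(* Main.v *)
From HB Require Import structures.
Require Import Defs.
From mathcomp Require Import all_boot all_algebra all_field.
From mathcomp Require Import boolp classical_sets functions cardinality.
From mathcomp Require Import ring.

Set Implicit Arguments.
Unset Strict Implicit.
Unset Printing Implicit Defensive.

Import GRing.Theory Num.Theory.
Local Open Scope ring_scope.
Local Open Scope classical_set_scope.

(** Two independent arguments.

Multiples of Q. If phi(P) = cQ, then psi = pr2 o phi o inl : T -> Td is a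
homomorphism over K with psi(R) = cR. On Td it must be multiplication by c:
composing psi - c with a coordinate Td -> Gm gives a character of a split torus
that vanishes at an independent point, and such a character is trivial, because
characters of Gm^r are monomials ([independent_character_eq0]). On Ta it must
vanish, because the coordinates of Td pull back to characters of the anisotropic
torus Ta. So c x = psi(x) = 0 for every point x of the intersection of Ta and
Td, over every K-algebra ([multiple_kills_inter]). The exponent of the geometric
points therefore divides c, and c = 1 would make the intersection trivial.

Orders. The points (d, 0) and (0, d) of G, for d in Td, are images of the same d
under two closed immersions of Td into G; so each coordinate of (0, d) is a
coordinate of (d, 0), up to a denominator when coordinates are taken on a model
over the S-integers. Precisely, for each function h on the model there are a
nonzero S-integer n and a function h' on the model with
n h(0, d) = h'(d, 0) for all d ([commensurable_points]). At a prime p where the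
finitely many denominators n attached to generators of the coordinate ring are
units and where P and Q are integral, k(R, 0) = 0 mod p then gives
h(0, kR) = h(0, 0) mod p for the generators h, that is, k(0, R) = 0 mod p
([finite_bad_reduction]).

The set of excluded primes is finite because an element of K is integral outside
finitely many primes ([finite_nonintegral_primes]): it has an integer as
denominator, and above a rational prime l there are finitely many primes since
O_K / l is a finite ring. *)

(** * Homomorphisms of group functors *)

Definition additive_of (U V : zmodType) (f : U -> V) (fB : zmod_morphism f) :
    {additive U -> V} :=
  HB.pack f (GRing.isZmodMorphism.Build U V f fB).

Definition rmorphism_of (U V : comPzRingType) (f : U -> V)
    (fB : zmod_morphism f) (fM : monoid_morphism f) : {rmorphism U -> V} :=
  HB.pack f (GRing.isZmodMorphism.Build U V f fB)
    (GRing.isMonoidMorphism.Build U V f fM).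

Definition gfHom_of (B : comPzRingType) (G G' : groupFunctor B)
    (F : forall A : alg B, G A -> G' A)
    (FB : forall A, zmod_morphism (F A))
    (Fnat : forall (A A' : alg B) (f : algHom A A') (x : G A),
      F A' (gf_map G f x) = gf_map G' f (F A x)) : gfHom G G' :=
  @GfHom B G G' (fun A => additive_of (FB A)) Fnat.

Section GroupFunctors.
Variable B : comPzRingType.
Implicit Types G : groupFunctor B.

Lemma comp_gfHom_subproof G1 G2 G3 (g : gfHom G2 G3) (f : gfHom G1 G2)
    (A : alg B) : zmod_morphism (g A \o f A).
Proof. by move=> x y; rewrite /= !raddfB. Qed.

Lemma comp_gfHom_nat G1 G2 G3 (g : gfHom G2 G3) (f : gfHom G1 G2)
    (A A' : alg B) (h : algHom A A') (x : G1 A) :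
  (g A' \o f A') (gf_map G1 h x) = gf_map G3 h ((g A \o f A) x).
Proof. by rewrite /= !gfHom_nat. Qed.

Definition comp_gfHom G1 G2 G3 (g : gfHom G2 G3) (f : gfHom G1 G2) :
    gfHom G1 G3 :=
  gfHom_of (comp_gfHom_subproof g f) (comp_gfHom_nat g f).

Lemma sub_gfHom_subproof G1 G2 (g f : gfHom G1 G2) (A : alg B) :
  zmod_morphism (fun x => g A x - f A x).
Proof.
have subACA (a b c d : G2 A) : a - b - (c - d) = a - c - (b - d).
  by rewrite !opprB (addrC d) addrACA (addrC (- b)).
by move=> x y; rewrite (raddfB (g A)) (raddfB (f A)) subACA.
Qed.

Lemma sub_gfHom_nat G1 G2 (g f : gfHom G1 G2)
    (A A' : alg B) (h : algHom A A') (x : G1 A) :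
  g A' (gf_map G1 h x) - f A' (gf_map G1 h x) = gf_map G2 h (g A x - f A x).
Proof. by rewrite !gfHom_nat raddfB. Qed.

Definition sub_gfHom G1 G2 (g f : gfHom G1 G2) : gfHom G1 G2 :=
  gfHom_of (sub_gfHom_subproof g f) (sub_gfHom_nat g f).

Lemma mul_gfHom_subproof G (c : nat) (A : alg B) :
  zmod_morphism (fun x : G A => x *+ c).
Proof. by move=> x y; rewrite mulrnBl. Qed.

Lemma mul_gfHom_nat G (c : nat) (A A' : alg B) (h : algHom A A') (x : G A) :
  gf_map G h x *+ c = gf_map G h (x *+ c).
Proof. by rewrite raddfMn. Qed.

Definition mul_gfHom G (c : nat) : gfHom G G :=
  gfHom_of (@mul_gfHom_subproof G c) (@mul_gfHom_nat G c).

Lemma incl_gfHom_subproof G (S : subGF G) (A : alg B) :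
  zmod_morphism (val : subPts S A -> G A).
Proof. exact: raddfB. Qed.

Definition incl_gfHom G (S : subGF G) : gfHom S G :=
  @gfHom_of B S G (fun A => val) (@incl_gfHom_subproof G S)
    (fun A A' f x => erefl).

Lemma inl_gfHom_subproof G G' (A : alg B) :
  zmod_morphism (fun x : G A => (x, 0) : prodGF G G' A).
Proof. by move=> x y; congr pair; rewrite subrr. Qed.

Lemma inl_gfHom_nat G G' (A A' : alg B) (h : algHom A A') (x : G A) :
  (gf_map G h x, 0) = gf_map (prodGF G G') h (x, 0).
Proof. by rewrite /= /prod_map raddf0. Qed.

Definition inl_gfHom G G' : gfHom G (prodGF G G') :=
  gfHom_of (@inl_gfHom_subproof G G') (@inl_gfHom_nat G G').

Lemma inr_gfHom_subproof G G' (A : alg B) :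
  zmod_morphism (fun x : G' A => (0, x) : prodGF G G' A).
Proof. by move=> x y; congr pair; rewrite subrr. Qed.

Lemma inr_gfHom_nat G G' (A A' : alg B) (h : algHom A A') (x : G' A) :
  (0, gf_map G' h x) = gf_map (prodGF G G') h (0, x).
Proof. by rewrite /= /prod_map raddf0. Qed.

Definition inr_gfHom G G' : gfHom G' (prodGF G G') :=
  gfHom_of (@inr_gfHom_subproof G G') (@inr_gfHom_nat G G').

Definition snd_gfHom G G' : gfHom (prodGF G G') G' :=
  @gfHom_of B (prodGF G G') G' (fun A => snd) (fun A x y => erefl)
    (fun A A' f x => erefl).

Lemma proj_gfHom_subproof G r (i : 'I_r) (A : alg B) :
  zmod_morphism (fun x : powGF G r A => x i).
Proof. by move=> x y; rewrite !ffunE. Qed.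

Lemma proj_gfHom_nat G r (i : 'I_r) (A A' : alg B) (h : algHom A A')
    (x : powGF G r A) :
  gf_map (powGF G r) h x i = gf_map G h (x i).
Proof. by rewrite ffunE. Qed.

Definition proj_gfHom G r (i : 'I_r) : gfHom (powGF G r) G :=
  gfHom_of (@proj_gfHom_subproof G r i) (@proj_gfHom_nat G r i).

Lemma axis_gfHom_subproof G r (i : 'I_r) (A : alg B) :
  zmod_morphism (fun x : G A => [ffun j => x *+ (j == i)] : powGF G r A).
Proof. by move=> x y; apply/ffunP => j; rewrite !ffunE mulrnBl. Qed.

Lemma axis_gfHom_nat G r (i : 'I_r) (A A' : alg B) (h : algHom A A') (x : G A) :
  [ffun j => gf_map G h x *+ (j == i)] =
  gf_map (powGF G r) h [ffun j => x *+ (j == i)].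
Proof. by apply/ffunP => j; rewrite !ffunE raddfMn. Qed.

Definition axis_gfHom G r (i : 'I_r) : gfHom G (powGF G r) :=
  gfHom_of (@axis_gfHom_subproof G r i) (@axis_gfHom_nat G r i).

Lemma powGF_sum G r (A : alg B) (x : powGF G r A) :
  x = \sum_(i < r) axis_gfHom G i A (x i).
Proof.
apply/ffunP => j; rewrite sum_ffunE (bigD1 j) //= ffunE eqxx big1 ?addr0 //.
by move=> i ij; rewrite ffunE eq_sym (negPf ij).
Qed.

Lemma gfIso_inverse G G' (f : gfHom G G') : gfIso f ->
  exists g : gfHom G' G,
    (forall A, cancel (f A) (g A)) /\ (forall A, cancel (g A) (f A)).
Proof.
move=> fiso.
have inv A : exists g : G' A -> G A, cancel (f A) g /\ cancel g (f A).
  by have [g fK gK] := fiso A; exists g.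
pose g A := sval (cid (inv A)); have gP A := svalP (cid (inv A)).
have gB A : zmod_morphism (g A).
  have [fK gK] := gP A => x y.
  by apply: (can_inj fK); rewrite raddfB !gK.
have gnat (A A' : alg B) (h : algHom A A') (x : G' A) :
    g A' (gf_map G' h x) = gf_map G h (g A x).
  have [fK _] := gP A'; have [_ gK] := gP A.
  by apply: (can_inj fK); rewrite gfHom_nat gK; have [_ ->] := gP A'.
by exists (gfHom_of gB gnat); split=> A; have [] := gP A.
Qed.

(** * Subalgebras and coordinate rings *)

(** The closure proof is an argument so that the ring structure can be inferred
from the type. *)
Definition subRing (A : comPzRingType) (E : {pred A})
    of GRing.subring_closed E := {x : A | x \in E}.
HB.instance Definition _ (A : comPzRingType) (E : {pred A})
    (E_closed : GRing.subring_closed E) :=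
  SubChoice.on (subRing E_closed).
HB.instance Definition _ (A : comPzRingType) (E : {pred A})
    (E_closed : GRing.subring_closed E) :=
  GRing.SubChoice_isSubComPzRing.Build A _ (subRing E_closed) E_closed.

Section Subalgebra.
Variables (A : alg B) (E : {pred A}).
Hypotheses (E_closed : GRing.subring_closed E)
  (E_str : forall b : B, alg_str A b \in E).

Let corestr (C : comPzRingType) (f : {rmorphism C -> A})
    (fE : forall c, f c \in E) (c : C) : subRing E_closed := Sub (f c) (fE c).

Let corestrB (C : comPzRingType) (f : {rmorphism C -> A})
    (fE : forall c, f c \in E) :
  zmod_morphism (corestr fE).
Proof. by move=> x y; apply: val_inj; rewrite /= raddfB. Qed.

Let corestrM (C : comPzRingType) (f : {rmorphism C -> A})
    (fE : forall c, f c \in E) :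
  monoid_morphism (corestr fE).
Proof. by split=> [|x y]; apply: val_inj; rewrite /= ?rmorph1 ?rmorphM. Qed.

Definition subalg : alg B :=
  @Alg B (subRing E_closed) (rmorphism_of (corestrB E_str) (corestrM E_str)).

Definition subalg_val : algHom subalg A :=
  @AlgHom B subalg A (val : subRing E_closed -> A) (fun=> erefl).

Lemma subalg_val_inj : injective subalg_val.
Proof. exact: val_inj. Qed.

Lemma subalg_valP (x : subalg) : subalg_val x \in E.
Proof. exact: (valP (x : subRing E_closed)). Qed.

Lemma subalg_corestr (C : comPzRingType) (f : {rmorphism C -> A}) :
    (forall c, f c \in E) ->
  exists g : {rmorphism C -> subalg}, forall c, subalg_val (g c) = f c.
Proof. by move=> fE; exists (rmorphism_of (corestrB fE) (corestrM fE)). Qed.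

End Subalgebra.

Lemma represents_inj G (H : alg B) (u : G H) (A : alg B)
    (f g : algHom H A) :
  represents u -> gf_map G f u = gf_map G g u -> f = g.
Proof. by move=> /(_ A (gf_map G g u))[k [_ kP]] fg; rewrite -(kP f fg) -(kP g). Qed.

(** If the universal point is defined over the subalgebra E, the point over E
defines a ring morphism H -> E that is a retraction by uniqueness, so E is all
of H. *)
Lemma represents_subalg_full G (H : alg B) (u : G H) (E : {pred H})
    (E_closed : GRing.subring_closed E)
    (E_str : forall b : B, alg_str H b \in E) :
  represents u ->
  (exists x : G (subalg E_closed E_str),
     gf_map G (subalg_val E_closed E_str) x = u) ->
  forall h : H, h \in E.
Proof.
move=> uP [x xu] h; have [f [fx _]] := uP _ x.
have -> : h = subalg_val E_closed E_str (f h); last exact: subalg_valP.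
have: compHom (subalg_val E_closed E_str) f = idHom H.
  by apply: (represents_inj uP); rewrite gf_comp fx xu gf_id.
by move=> /(congr1 (fun k : algHom H H => k h)).
Qed.

Definition generates (H : alg B) (s : seq H) : Prop :=
  forall E : {pred H}, GRing.subring_closed E ->
    (forall b : B, alg_str H b \in E) -> {subset s <= E} ->
    forall h : H, h \in E.

(** The elements of the coordinate ring where f and g agree form a subalgebra. *)
Lemma represents_finite_eq G (H : alg B) (u : G H) (s : seq H) :
    represents u ->
    generates s ->
  forall (A : alg B) (f g : algHom H A),
    {in s, f =1 g} -> gf_map G f u = gf_map G g u.
Proof.
move=> uP sP A f g fg; congr (gf_map G _ u); apply: algHom_eq => h.
apply/eqP; apply: (sP (fun h => f h == g h)) => [|b|k ks].
- split=> [|x y|x y]; rewrite -!topredE /= ?rmorph1 // ?rmorphB ?rmorphM.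
  + by move=> /eqP-> /eqP->.
  + by move=> /eqP-> /eqP->.
- by rewrite -topredE /= !algHom_str.
- exact/eqP/fg.
Qed.

(** Membership in S is the vanishing of certain functions at the point, and an
injective morphism reflects zero. *)
Lemma closedSub_descent G (S : subGF G) (A A' : alg B) (j : algHom A A')
    (x : G A) :
  closedSub S -> injective j -> gf_map G j x \in S A' -> x \in S A.
Proof.
move=> [H [u [uP [I IP]]]] j_inj; have [f [<- _]] := uP _ x.
rewrite -gf_comp => /IP fI; apply/IP => h hI.
by apply: j_inj; rewrite rmorph0; exact: fI.
Qed.

End GroupFunctors.

(** * Characters of split tori *)

(** Polynomial evaluation needs a nontrivial ring, whereas an algebra may be
trivial; in the trivial case every map is a morphism. *)
Lemma horner_alg_exists (K : comNzRingType) (A : alg K) (x : A) :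
  exists ev : {rmorphism {poly K} -> A},
    (forall k, ev k%:P = alg_str A k) /\ ev 'X = x.
Proof.
have [A1|A1] := eqVneq (1 : A) 0.
  have allE (a b : A) : a = b by rewrite -[a]mulr1 -[b]mulr1 A1 !mulr0.
  have cB : zmod_morphism (fun _ : {poly K} => 0 : A) by [].
  have cM : monoid_morphism (fun _ : {poly K} => 0 : A) by split.
  by exists (rmorphism_of cB cM).
pose A' : comNzRingType :=
  HB.pack (GRing.ComPzRing.sort A) (alg_ring A) (GRing.PzSemiRing_isNonZero.Build A A1).
pose s : {rmorphism K -> A'} := alg_str A.
have cx : commr_rmorph s (x : A') by move=> y; exact: mulrC.
exists (horner_morph cx : {rmorphism {poly K} -> A'}); split=> [k|].
  exact: (horner_morphC cx).
exact: (horner_morphX cx).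
Qed.

Lemma gm_valD (A : comPzRingType) (x y : gmPts A) :
  gm_val (x + y) = gm_val x * gm_val y.
Proof. by []. Qed.

Lemma gm_valMn (A : comPzRingType) (x : gmPts A) n :
  gm_val (x *+ n) = gm_val x ^+ n.
Proof. by elim: n => [|n IHn] //; rewrite mulrS exprS -IHn. Qed.

Lemma gm_invMn (A : comPzRingType) (x : gmPts A) n :
  gm_inv (x *+ n) = gm_inv x ^+ n.
Proof. by rewrite -[gm_inv x]/(gm_val (- x)) -gm_valMn mulNrn. Qed.

Section Characters.
Variable K : fieldType.
Local Notation "p %:F" := (@tofrac {poly K} p).

(** The field K(T). *)
Definition ratFun : alg K :=
  @Alg K {fraction {poly K}} (@tofrac {poly K} \o polyC).

Let T : ratFun := 'X%:F.
Let TV : ratFun := ('X%:F)^-1.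

Lemma gm_T_subproof : (T, TV).1 * (T, TV).2 == 1.
Proof. by rewrite /= /T /TV mulfV // tofrac_eq0 polyX_eq0. Qed.

Definition gm_T : gmPts ratFun := Sub (T, TV) gm_T_subproof.

(** For a unit x of A, the Laurent polynomials in the unit (x, T) of A * K(T) form
an algebra that maps to both factors. It plays the role of K[T, 1/T]: a
character takes the unit (x, T) to one of its units, so one Laurent polynomial
describes the values of the character both at x and at T. *)
Section Evaluation.
Variables (A : alg K) (x : gmPts A) (ev : {rmorphism {poly K} -> A}).
Hypotheses (evC : forall k, ev k%:P = alg_str A k) (evX : ev 'X = gm_val x).

Let diag (k : K) : A * ratFun := (alg_str A k, alg_str ratFun k).

Let diagB : zmod_morphism diag.
Proof. by move=> a b; rewrite /diag !rmorphB. Qed.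

Let diagM : monoid_morphism diag.
Proof. by split=> [|a b]; rewrite /diag ?rmorph1 ?rmorphM. Qed.

Definition prodAlg : alg K :=
  @Alg K (A * ratFun)%type (rmorphism_of diagB diagM).

Definition prodAlg_fst : algHom prodAlg A :=
  @AlgHom K prodAlg A (fst : A * ratFun -> A) (fun=> erefl).
Definition prodAlg_snd : algHom prodAlg ratFun :=
  @AlgHom K prodAlg ratFun (snd : A * ratFun -> ratFun) (fun=> erefl).

Definition laurent : {pred prodAlg} := fun z =>
  `[< exists (p : {poly K}) (n : nat),
        z = (ev p * gm_inv x ^+ n, p%:F * gm_inv gm_T ^+ n) >].

Let evXV n : ev ('X^n) * gm_inv x ^+ n = 1.
Proof. by rewrite rmorphXn /= evX -exprMn gm_valV expr1n. Qed.

Let TXV n : ('X^n : {poly K})%:F * gm_inv gm_T ^+ n = 1.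
Proof. by rewrite rmorphXn /= -exprMn (gm_valV gm_T) expr1n. Qed.

Lemma laurent_closed : GRing.subring_closed laurent.
Proof.
split.
- by apply/asboolP; exists 1, 0; rewrite !rmorph1 !expr0 !mulr1.
- move=> _ _ /asboolP[p [n ->]] /asboolP[q [m ->]]; apply/asboolP.
  exists (p * 'X^m - q * 'X^n), (n + m); congr pair => /=.
    rewrite rmorphB !rmorphM mulrBl !exprD; congr (_ - _).
      by rewrite mulrACA evXV mulr1.
    by rewrite [gm_inv x ^+ n * _]mulrC mulrACA evXV mulr1.
  rewrite rmorphB !rmorphM mulrBl !exprD; congr (_ - _).
    by rewrite mulrACA TXV mulr1.
  by rewrite [gm_inv _ ^+ n * _]mulrC mulrACA TXV mulr1.
- move=> _ _ /asboolP[p [n ->]] /asboolP[q [m ->]]; apply/asboolP.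
  by exists (p * q), (n + m); congr pair => /=; rewrite !rmorphM exprD mulrACA.
Qed.

Lemma laurent_str b : alg_str prodAlg b \in laurent.
Proof.
by apply/asboolP; exists b%:P, 0%N; rewrite !expr0 !mulr1 evC.
Qed.

Notation laurentAlg := (subalg laurent_closed laurent_str).

Lemma gm_graph_subproof :
  ((gm_val x, gm_val gm_T) : prodAlg) * (gm_inv x, gm_inv gm_T) = 1.
Proof. by congr pair; rewrite /= gm_valV. Qed.

Lemma laurent_val : ((gm_val x, gm_val gm_T) : prodAlg) \in laurent.
Proof.
by apply/asboolP; exists 'X, 0%N; rewrite !expr0 !mulr1 evX.
Qed.

Lemma laurent_inv : ((gm_inv x, gm_inv gm_T) : prodAlg) \in laurent.
Proof.
by apply/asboolP; exists 1, 1%N; rewrite !expr1 !rmorph1 !mul1r.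
Qed.

Lemma gm_graph_exists : exists z : gmPts laurentAlg,
  gm_map (compHom prodAlg_fst (subalg_val laurent_closed laurent_str)) z = x /\
  gm_map (compHom prodAlg_snd (subalg_val laurent_closed laurent_str)) z = gm_T.
Proof.
pose a : laurentAlg :=
  (Sub ((gm_val x, gm_val gm_T) : prodAlg) laurent_val : subRing laurent_closed).
pose b : laurentAlg :=
  (Sub ((gm_inv x, gm_inv gm_T) : prodAlg) laurent_inv : subRing laurent_closed).
have ab : (a, b).1 * (a, b).2 == 1.
  apply/eqP; apply: (@subalg_val_inj _ _ _ laurent_closed laurent_str).
  by rewrite rmorph1 rmorphM; exact: gm_graph_subproof.
by exists (Sub (a, b) ab); split; apply: gm_inj.
Qed.

Lemma character_Laurent (chi : gfHom (Gm K) (Gm K)) :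
  exists (p q : {poly K}) (n m : nat),
    [/\ gm_val (chi A x) = ev p * gm_inv x ^+ n,
        gm_val (chi ratFun gm_T) = p%:F * gm_inv gm_T ^+ n &
        gm_inv (chi ratFun gm_T) = q%:F * gm_inv gm_T ^+ m].
Proof.
have [z [zx zT]] := gm_graph_exists.
have /asboolP[p [n pnE]] := subalg_valP (gm_val (chi laurentAlg z)).
have /asboolP[q [m qmE]] := subalg_valP (gm_inv (chi laurentAlg z)).
exists p, q, n, m; split.
- rewrite -[in LHS]zx (gfHom_nat chi (compHom _ _) z).
  exact: (congr1 fst pnE).
- rewrite -[in LHS]zT (gfHom_nat chi (compHom _ _) z).
  exact: (congr1 snd pnE).
- rewrite -[in LHS]zT (gfHom_nat chi (compHom _ _) z).
  exact: (congr1 snd qmE).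
Qed.

End Evaluation.

Lemma gm_T_clear (p q : {poly K}) n m :
  p%:F * gm_inv gm_T ^+ n = q%:F * gm_inv gm_T ^+ m ->
  p * 'X^m = q * 'X^n.
Proof.
have VK k : gm_inv gm_T ^+ k * gm_val gm_T ^+ k = 1.
  by rewrite -exprMn mulrC gm_valV expr1n.
have valX k : gm_val gm_T ^+ k = ('X^k : {poly K})%:F by rewrite rmorphXn.
move=> /(congr1 (fun z => z * gm_val gm_T ^+ n * gm_val gm_T ^+ m)).
rewrite -[_ * _ * gm_val gm_T ^+ n]mulrA VK mulr1.
rewrite mulrAC -[_ * _ * gm_val gm_T ^+ m]mulrA VK mulr1 !valX.
by rewrite -!(rmorphM (@tofrac {poly K})) => /eqP; rewrite tofrac_eq => /eqP.
Qed.

(** The values of chi at T and its inverse are p/T^n0 and q/T^m0 with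
p q = X^(n0 + m0), so p is a X^k; evaluating at the unit 1, which chi fixes,
gives a = 1. Hence chi(T) = T^k/T^n0, and chi(x) is given by the same Laurent
polynomial as chi(T) for every unit x. *)
Lemma gm_character (chi : gfHom (Gm K) (Gm K)) :
  exists m : int, forall (A : alg K) (x : gmPts A), chi A x = x *~ m.
Proof.
have [ev0 [ev0C ev0X]] := @horner_alg_exists K (selfAlg K) (gm_val 0).
have [p0 [q0 [n0 [m0 [p0E p0T q0T]]]]] :=
  character_Laurent ev0C ev0X chi.
have p0q0 : p0 * q0 = 'X^(n0 + m0).
  have := gm_valV (chi ratFun gm_T); rewrite p0T q0T mulrACA -exprD.
  move=> pqT; rewrite -[LHS]mulr1 -(expr0 'X) -[RHS]mul1r.
  by apply: gm_T_clear; rewrite expr0 mulr1 rmorphM rmorph1.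
have [k p0k] : exists k, p0 = 'X^k.
  have : p0 %| 'X^(n0 + m0) by rewrite -p0q0 dvdp_mulr.
  rewrite -['X]subr0 -polyC0 => /dvdp_exp_XsubCP[k _].
  rewrite polyC0 subr0 => /eqpfP; rewrite lead_coefXn divr1.
  move: (lead_coef p0) => a p0E'.
  exists k; rewrite p0E'.
  have := p0E; rewrite raddf0 (_ : gm_inv 0 = 1) // expr1n mulr1 => /esym.
  rewrite p0E' -mul_polyC rmorphM rmorphXn /= ev0X expr1n mulr1 ev0C /= => ->.
  by rewrite mul1r.
exists (k%:Z - n0%:Z) => A x.
(* The two expressions p/T^n and T^k/T^n0 of chi(T) agree as polynomials once
denominators are cleared, hence also after evaluation at x. *)
have [ev [evC evX]] := horner_alg_exists (gm_val x).
have [p [q [n [m [pE pT _]]]]] := character_Laurent evC evX chi.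
have pX : p * 'X^n0 = 'X^(k + n).
  by rewrite exprD -p0k; apply: gm_T_clear; rewrite -pT p0T.
apply: gm_inj; rewrite mulrzBr -!pmulrn gm_valD gm_valMn.
rewrite -[gm_val (- _)]/(gm_inv _) gm_invMn pE.
have := congr1 ev pX; rewrite rmorphM !rmorphXn /= evX => evpX.
have xV j : gm_val x ^+ j * gm_inv x ^+ j = 1.
  by rewrite -exprMn gm_valV expr1n.
rewrite -[ev p]mulr1 -(xV n0) mulrA evpX exprD.
rewrite -!mulrA; congr (_ * _).
by rewrite mulrCA xV mulr1.
Qed.

End Characters.

Lemma powGm_character (K : fieldType) r (chi : gfHom (powGF (Gm K) r) (Gm K)) :
  exists m : 'I_r -> int, forall (A : alg K) (x : powGF (Gm K) r A),
    chi A x = \sum_(i < r) x i *~ m i.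
Proof.
have mP i := gm_character (comp_gfHom chi (axis_gfHom (Gm K) i)).
exists (fun i => sval (cid (mP i))) => A x; rewrite [x in LHS]powGF_sum raddf_sum.
by apply: eq_bigr => i _; exact: (svalP (cid (mP i))).
Qed.

Lemma gm_val_sum_mulrz (K : fieldType) (I : finType)
    (x : I -> gmPts (selfAlg K)) (m : I -> int) :
  gm_val (\sum_i x i *~ m i) = \prod_i (gm_val (x i) : K) ^ m i.
Proof.
have gm_valMz (y : gmPts (selfAlg K)) (n : int) :
    gm_val (y *~ n) = (gm_val y : K) ^ n.
  case: n => n; first by rewrite -pmulrn gm_valMn.
  rewrite NegzE mulrNz -pmulrn -mulNrn gm_valMn -exprnN -exprVn; congr (_ ^+ _).
  have y0 : (gm_val y : K) != 0.
    by apply: contra_eq_neq (gm_valV y) => ->; rewrite mul0r eq_sym oner_eq0.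
  by apply: (mulfI y0); rewrite mulfV //; exact: (gm_valV y).
elim/big_rec2: _ => [|i y z _ <-]; first by [].
by rewrite gm_valD gm_valMz.
Qed.

(** A character is a monomial in the coordinates, so its vanishing at R is a
multiplicative relation between the coordinates of R. *)
Lemma independent_character_eq0 (K : fieldType) (D : groupFunctor K)
    (R : D (selfAlg K)) (chi : gfHom D (Gm K)) :
  independent R -> chi _ R = 0 -> forall (A : alg K) (x : D A), chi A x = 0.
Proof.
move=> [r [f [/gfIso_inverse[g [fK gK]] indep]]] chiR A x.
have [m mE] := powGm_character (comp_gfHom chi g).
have chiE B (y : D B) : chi B y = \sum_(i < r) f B y i *~ m i.
  by rewrite -mE /= fK.
have m0 i : m i = 0.
  by apply: indep; rewrite -gm_val_sum_mulrz -chiE chiR.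
by rewrite chiE big1 // => i _; rewrite m0 mulr0z.
Qed.

(** psi is multiplication by c on Td, by independence of R, and zero on Ta, by
anisotropy; both descriptions apply to points of the intersection. *)
Lemma multiple_kills_inter (K : fieldType) (T : groupFunctor K)
    (Ta Td : subGF T) (R : subFunctor Td (selfAlg K))
    (psi : gfHom T Td) (c : nat) :
    isAnisotropic Ta -> independent R -> psi _ (val R) = R *+ c ->
  forall (A : alg K) (x : T A), x \in interGF Ta Td A -> x *+ c = 0.
Proof.
move=> aniso indep psiR A x /andP[xa xd].
have [r [f [fiso _]]] := indep.
have [g fK gK] := fiso A.
have cancel_f (y z : subFunctor Td A) : (forall i, f A y i = f A z i) -> y = z.
  by move=> yz; apply: (can_inj fK); apply/ffunP.
pose xD : subFunctor Td A := (Sub x xd : subPts Td A).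
pose xA : subFunctor Ta A := (Sub x xa : subPts Ta A).
have psi_c : psi A x = xD *+ c.
  apply: cancel_f => i; apply/eqP; rewrite -subr_eq0; apply/eqP.
  pose chi := comp_gfHom (proj_gfHom (Gm K) i) (comp_gfHom f
    (sub_gfHom (comp_gfHom psi (incl_gfHom Td)) (mul_gfHom Td c))).
  have chiR : chi _ R = 0.
    by rewrite /chi /= psiR subrr (raddf0 (f _)) ffunE.
  have : f A (psi A x - xD *+ c) i = 0.
    exact: (independent_character_eq0 indep chiR xD).
  by rewrite raddfB !ffunE.
have psi_0 : psi A x = 0.
  apply: cancel_f => i; rewrite raddf0 ffunE.
  exact: (aniso (comp_gfHom (proj_gfHom (Gm K) i)
    (comp_gfHom f (comp_gfHom psi (incl_gfHom Ta)))) A xA).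
have : val (xD *+ c) = 0 by rewrite -psi_c psi_0 raddf0.
by rewrite raddfMn.
Qed.

(** * Finiteness of the primes where an element is not integral *)

(** When a relation modulo l gives x a coefficient c prime to l, this expresses x
modulo l through the other terms of the relation. *)
Lemma bezout_split (V : zmodType) (x y : V) (u v c : int) (l : nat) :
  u * c + v * l%:Z = 1 ->
  x = y *~ u *+ l + x *~ v *+ l - (y *+ l - x *~ c) *~ u.
Proof.
move=> uv; rewrite !pmulrn mulrzBl -!mulrzA [l%:Z * u]mulrC [c * u]mulrC.
by rewrite opprB addrC addrA subrK -mulrzDr uv.
Qed.

Section Primes.
Variable K : fieldExtType rat.
Local Notation OK := (ringOfIntegers K).

Lemma intK_eq0 (n : int) : (n%:~R == 0 :> K) = (n == 0).
Proof. by rewrite -scaler_int scaler_eq0 oner_eq0 orbF intr_eq0. Qed.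

(** The integral coefficients of the relation form a polynomial, so that clearing
denominators and dividing by the common factor are available as the content
theory of polynomials. *)
Lemma int_dependence (e : nat -> K) :
  exists q : {poly int}, [/\ zcontents q = 1, (size q <= (\dim {:K}).+1)%N &
    \sum_(i < (\dim {:K}).+1) e i *~ q`_i = 0].
Proof.
set n := \dim _.
have : ~~ free [tuple e i | i < n.+1].
  apply/negP; rewrite /free => /eqP dimE.
  have := dimvS (subvf <<[tuple e i | i < n.+1]>>).
  by rewrite dimE size_tuple ltnn.
move=> /freeP e_dep.
have [k [kE [i0 k_i0]]] : exists k : 'I_n.+1 -> rat,
    \sum_(i < n.+1) k i *: e i = 0 /\ exists i, k i != 0.
  apply: contra_notP e_dep => nk k kE i; apply/eqP; apply: contra_notT nk => ki.
  exists k; split; last by exists i.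
  by rewrite -[RHS]kE; apply: eq_bigr => j _; rewrite -tnth_nth tnth_mktuple.
have [q [a a0 qE]] := rat_poly_scale (\poly_(i < n.+1) k (inord i)).
have kq (i : 'I_n.+1) : k i = a%:~R^-1 * (q`_i)%:~R.
  transitivity (\poly_(j < n.+1) k (inord j))`_i.
    by rewrite coef_poly ltn_ord inord_val.
  by rewrite qE coefZ coef_map.
have q0 : q != 0.
  apply: contraNneq k_i0 => q0.
  by rewrite kq q0 coef0 mulr0.
have sz_q : (size q <= n.+1)%N.
  rewrite -(size_map_inj_poly (f := intr : int -> rat)) ?rmorph0 //; last exact: intr_inj.
  rewrite -(@size_scale _ (a%:~R^-1)) ?invr_eq0 ?intr_eq0 // -qE.
  exact: size_poly.
exists (zprimitive q); split; first by rewrite zcontents_primitive q0.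
  by rewrite size_zprimitive.
have c0 : (a%:~R^-1 * (zcontents q)%:~R : rat) != 0.
  by rewrite mulf_neq0 ?invr_eq0 ?intr_eq0 // zcontents_eq0.
apply: (scalerI c0); rewrite scaler0 -[RHS]kE scaler_sumr.
apply: eq_bigr => i _; rewrite kq {3}[q]zpolyEprim.
have -> : (zcontents q *: zprimitive q)`_i = zcontents q * (zprimitive q)`_i.
  by rewrite coefZ.
rewrite intrM mulrA.
by rewrite -[RHS]scalerA scaler_int.
Qed.

(** An integral relation between powers of x, with leading coefficient b, becomes
a monic equation for b x after multiplication by a power of b. *)
Lemma integral_int_multiple (x : K) :
  exists2 b : int, b != 0 & integralOver (intr : int -> K) (b%:~R * x).
Proof.
have [q [q1 sz_q qx]] := int_dependence (fun i => x ^+ i).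
have q0 : q != 0 by rewrite -zcontents_eq0 q1.
have {qx sz_q} qx : \sum_(i < size q) x ^+ i *~ q`_i = 0.
  rewrite -[RHS]qx (big_ord_widen _ (fun i => x ^+ i *~ q`_i) sz_q) big_mkcond.
  apply: eq_bigr => i _; case: ltnP => // /(nth_default 0) ->.
  by rewrite mulr0z.
have [m sz_q] : exists m, size q = m.+2.
  case sz_q: (size q) qx => [|[|m]] qx; last by exists m.
    by move/eqP: sz_q; rewrite size_poly_eq0 (negPf q0).
  move/eqP: qx; rewrite big_ord1 /= expr0 intK_eq0 => /eqP q_0.
  by move: q0; rewrite -lead_coef_eq0 lead_coefE sz_q /= q_0 eqxx.
have b0 : q`_m.+1 != 0 by move: q0; rewrite -lead_coef_eq0 lead_coefE sz_q.
exists q`_m.+1 => //; set b := q`_m.+1 in b0 *.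
(* The polynomial b^m q(X / b). *)
pose P := \poly_(i < m.+2) (if i == m.+1 then 1 else q`_i * b ^+ (m - i)).
have szP : size P = m.+2 by rewrite size_poly_eq //= eqxx oner_eq0.
exists P; first by rewrite monicE lead_coefE szP coef_poly ltnSn eqxx.
apply/rootP; rewrite (horner_coef_wide (n := m.+2)); last first.
  by rewrite -szP size_poly.
rewrite big_ord_recr /= coef_map coef_poly ltnSn eqxx /= mulr1z mul1r.
transitivity (b%:~R ^+ m * \sum_(i < size q) x ^+ i *~ q`_i); last first.
  by rewrite qx mulr0.
rewrite sz_q [in RHS]big_ord_recr mulrDr /=; congr (_ + _).
  rewrite big_distrr; apply: eq_bigr => i _ /=.
  rewrite coef_map coef_poly (ltnW (ltn_ord i) : i < m.+2)%N (ltn_eqF (ltn_ord i)).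
  rewrite /= rmorphM rmorphXn /= exprMn.
  have -> : b%:~R ^+ m = b%:~R ^+ (m - i) * b%:~R ^+ i :> K.
    by rewrite -exprD subnK // -ltnS.
  by rewrite -mulrzr; ring.
by rewrite -/b -mulrzr exprMn exprSr; ring.
Qed.

(** Linear independence over F_l of the classes in O_K / l. *)
Definition indep_mod (l : nat) (es : seq OK) : Prop :=
  forall c : nat -> int,
    (exists y : OK, \sum_(i < size es) es`_i *~ c i = y *+ l) ->
  forall i, (i < size es)%N -> (l %| c i)%Z.

(** One more element would give a relation with coprime integral coefficients,
which is nontrivial modulo l. *)
Lemma indep_mod_size l es :
  prime l -> indep_mod l es -> (size es <= \dim {:K})%N.
Proof.
move=> l_prime es_indep; rewrite leqNgt; apply/negP => size_es.
have [q [q1 sz_q qE]] := int_dependence (fun i => val (es`_i)).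
set n := \dim _ in size_es sz_q qE.
suff : (l %| zcontents q)%Z.
  by rewrite q1 dvdz1 /= => /eqP l1; rewrite l1 in l_prime.
have lq : forall i, (i < size es)%N -> (l %| q`_i)%Z.
  apply: es_indep; exists 0; rewrite mul0rn; apply: val_inj.
  rewrite raddf_sum raddf0 -[RHS]qE.
  rewrite (big_ord_widen _ (fun i => val es`_i *~ q`_i) size_es).
  rewrite [RHS]big_mkcond; apply: eq_bigr => j _; rewrite raddfMz.
  case: ltnP => // /(leq_trans sz_q) q_j.
  by rewrite (nth_default 0 q_j) mulr0z.
rewrite dvdz_contents; apply/polyOverP => i.
have [/lq //|/(leq_trans size_es)] := ltnP i (size es).
by move=> /(leq_trans sz_q)/(nth_default 0) ->; exact: dvdz0.
Qed.

(** A family of maximal size among those independent modulo l spans O_K / l, so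
this ring has finitely many elements. *)
Lemma span_mod l : prime l -> exists es : seq OK, forall x : OK,
  exists k : {ffun 'I_(size es) -> 'I_l}, exists y : OK,
    x = \sum_(i < size es) es`_i *+ k i + y *+ l.
Proof.
move=> l_prime.
pose P k := `[< exists es, indep_mod l es /\ size es = k >].
have exP : exists k, P k.
  by exists 0%N; apply/asboolP; exists [::]; split.
have ubP k : P k -> (k <= \dim {:K})%N.
  by move=> /asboolP[es [esP <-]]; exact: indep_mod_size esP.
case: (ex_maxnP exP ubP) => k /asboolP[es [es_indep sz_es]] k_max.
have l0 : (l%:Z != 0) by rewrite -lt0n prime_gt0.
exists es => x.
have : ~ indep_mod l (x :: es).
  move=> xes; have : (size (x :: es) <= k)%N.
    by apply: k_max; apply/asboolP; exists (x :: es).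
  by rewrite /= sz_es ltnn.
move=> /existsNP[c /not_implyP[[y yE] /existsNP[i /not_implyP[i_lt lci]]]].
have {}yE : x *~ c 0%N + \sum_(i < size es) es`_i *~ c i.+1 = y *+ l.
  by rewrite -yE /= big_ord_recl.
have c0 : ~~ (l %| c 0%N)%Z.
  apply/negP => /dvdzP[d dE]; apply: lci.
  case: i i_lt => [_|i]; first by rewrite dE dvdz_mull.
  rewrite /= ltnS => i_lt; apply: (es_indep (fun i => c i.+1)) i_lt.
  exists (y - x *~ d).
  by rewrite mulrnBl -yE dE mulrzA -pmulrn addrC addKr.
clear i i_lt lci.
have /coprimezP[[u v] /= uv] : coprimez (c 0%N) l%:Z.
  by rewrite coprimez_sym coprimezE /= prime_coprime.
pose d (i : 'I_(size es)) := - (c i.+1 * u).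
have lpos : (0 < l)%N by rewrite prime_gt0.
have dlt (i : 'I_(size es)) : (`|(d i %% l%:Z)%Z|%N < l)%N.
  by rewrite -ltz_nat gez0_abs ?modz_ge0 // ltz_pmod.
exists [ffun i => Ordinal (dlt i)].
exists (y *~ u + x *~ v + \sum_(i < size es) es`_i *~ (d i %/ l%:Z)%Z).
rewrite !mulrnDl -sumrMnl addrCA -big_split /=.
have -> : \sum_(i < size es) (es`_i *+ [ffun i => Ordinal (dlt i)] i
   + es`_i *~ (d i %/ l%:Z)%Z *+ l) = \sum_(i < size es) es`_i *~ d i.
  apply: eq_bigr => j _; rewrite ffunE /= [in RHS](divz_eq (d j) l) mulrzDr.
  rewrite addrC mulrzA pmulrn; congr (_ + _).
  by rewrite pmulrn gez0_abs // modz_ge0.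
rewrite /d; under eq_bigr do rewrite mulrNz mulrzA.
rewrite sumrN -mulrz_suml.
have -> : \sum_(i < size es) es`_i *~ c i.+1 = y *+ l - x *~ c 0%N.
  by rewrite -yE addrC addKr.
exact: bezout_split.
Qed.

(** A prime above l is the preimage of a subset of the finite ring O_K / l; the
code of a prime lists the representatives that it contains. *)
Lemma finite_primes_over_prime (l : nat) : prime l ->
  finite_set [set p : primeOf K | (l%:R : OK) \in prime_set p].
Proof.
move=> /span_mod[es esP]; set F := [set p | _].
pose code (p : primeOf K) : {ffun {ffun 'I_(size es) -> 'I_l} -> bool} :=
  [ffun k : {ffun 'I_(size es) -> 'I_l} =>
    (\sum_(i < size es) es`_i *+ k i) \in prime_set p].
have codeP p x (k : {ffun 'I_(size es) -> 'I_l}) (y : OK) : F p ->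
    x = \sum_(i < size es) es`_i *+ k i + y *+ l ->
    (x \in prime_set p) = code p k.
  move=> lp xE.
  have ylp : y *+ l \in prime_set p by rewrite -mulr_natr prime_memMl.
  have ylN : - (y *+ l) \in prime_set p.
    by rewrite -[- _]add0r prime_memB // prime_mem0.
  rewrite ffunE; apply/idP/idP => [xp|kp].
    by rewrite -[X in X \in _](addrK (y *+ l)) -xE prime_memB.
  by rewrite xE -[y *+ l]opprK prime_memB.
have code_inj : {in F &, injective code}.
  move=> p q /set_mem lp /set_mem lq pq.
  have : prime_set p = prime_set q.
    apply/funext => x; have [k [y xE]] := esP x.
    have e : (x \in prime_set p) = (x \in prime_set q).
      by rewrite (codeP p x k y) // (codeP q x k y) // pq.
    exact: e.
  case: p q {lp lq pq} => [s i pr n0] [s' i' pr' n0'] /= ss'.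
  case: _ / ss' in i' pr' n0' *.
  by congr PrimeOf; exact: Prop_irrelevance.
have <- := eq_finite_set (inj_card_eq code_inj).
exact: finite_finset.
Qed.

Lemma finite_primes_over_nat (b : nat) : (0 < b)%N ->
  finite_set [set p : primeOf K | (b%:R : OK) \in prime_set p].
Proof.
elim/ltn_ind: b => b IHb b0.
have [b1|b1] := leqP b 1.
  have -> : b = 1%N by apply/eqP; rewrite eqn_leq b1.
  rewrite (_ : [set p | _] = set0) // -subset0 => p /=.
  by rewrite (negPf (prime_notin1 p)).
have bE : b = (pdiv b * (b %/ pdiv b))%N by rewrite mulnC divnK // pdiv_dvd.
have b'0 : (0 < b %/ pdiv b)%N by rewrite divn_gt0 ?pdiv_gt0 // pdiv_leq.
have b'b : (b %/ pdiv b < b)%N by rewrite ltn_Pdiv // prime_gt1 // pdiv_prime.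
apply: (@sub_finite_set _ _
  ([set p : primeOf K | ((pdiv b)%:R : OK) \in prime_set p] `|`
   [set p : primeOf K | ((b %/ pdiv b)%:R : OK) \in prime_set p])).
  move=> p /=; rewrite {1}bE natrM => /(prime_prime (p := p)) /orP[]; by [left|right].
rewrite finite_setU; split; first exact/finite_primes_over_prime/pdiv_prime.
exact: IHb.
Qed.

(** If b x is integral for the nonzero integer b, then x is in the local ring at
every prime that does not contain b. *)
Lemma finite_nonintegral_primes (x : K) :
  finite_set [set p : primeOf K | x \notin localRing_pred p].
Proof.
have [b b0 bx] := integral_int_multiple x.
have b_pos : (0 < `|b|%N)%N by rewrite absz_gt0.
apply: sub_finite_set (finite_primes_over_nat b_pos) => p /=.
apply: contraNT => bp; apply/asboolP.
have bxO : b%:~R * x \in @ringOfIntegers_pred K by exact/asboolP.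
exists (Sub (b%:~R * x) bxO), (b%:~R); split.
  apply: contraNN bp => bp.
  have -> : `|b|%N%:R = (sgz b)%:~R * b%:~R :> OK.
    by rewrite -intrM -abszEsg pmulrn.
  exact: prime_memMl.
by rewrite SubK rmorph_int mulrAC mulfV ?mul1r // intK_eq0.
Qed.

End Primes.

(** * Coordinates of two immersions into a model *)

Section Commensurable.
Variables (B : comPzRingType) (K : fieldType) (j : {rmorphism B -> K}).
Hypothesis j_frac :
  forall k : K, exists b n : B, j n != 0 /\ j n * k = j b.
Variables (D : groupFunctor K) (Hd : alg K) (ud : D Hd).
Hypothesis udP : represents ud.
Variables (M : groupFunctor B) (H : alg B) (v : M H).
Hypothesis vP : represents v.
Variable iP : gfHom D (baseChange j M).
(** This holds when iP is a closed immersion. *)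
Hypothesis iP_descent : forall (A A' : alg K) (e : algHom A A')
    (y : baseChange j M A) (d' : D A'),
  injective e -> gf_map (baseChange j M) e y = iP A' d' ->
  exists d : D A, gf_map D e d = d'.

(** The elements x with a multiple n x in the image of theta form a K-subalgebra
that contains the image of theta. The universal point of D is defined over it:
its image in M is, and iP descends. *)
Lemma commensurable_coordinates (theta : algHom H (restrAlg j Hd)) :
    gf_map M theta v = iP Hd ud ->
  forall x : Hd, exists n h, j n != 0 /\ alg_str Hd (j n) * x = theta h.
Proof.
move=> thetaP.
pose E : {pred Hd} := fun x =>
  `[< exists n h, j n != 0 /\ alg_str Hd (j n) * x = theta h >].
have theta_str b : theta (alg_str H b) = alg_str Hd (j b).
  exact: (algHom_str theta).
have Ecl : GRing.subring_closed E.
  split.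
  - apply/asboolP; exists 1, 1.
    by rewrite !rmorph1 mulr1 oner_neq0.
  - move=> x y /asboolP[n [h [n0 nx]]] /asboolP[m [k [m0 my]]].
    apply/asboolP; exists (n * m), (alg_str H m * h - alg_str H n * k).
    split; first by rewrite rmorphM mulf_neq0.
    rewrite rmorphB !rmorphM !theta_str -nx -my mulrBr.
    by congr (_ - _); rewrite -?mulrA // mulrCA !mulrA.
  - move=> x y /asboolP[n [h [n0 nx]]] /asboolP[m [k [m0 my]]].
    apply/asboolP; exists (n * m), (h * k).
    split; first by rewrite rmorphM mulf_neq0.
    by rewrite !rmorphM -nx -my mulrACA.
have Estr k : alg_str Hd k \in E.
  have [b [n [n0 nk]]] := j_frac k.
  apply/asboolP; exists n, (alg_str H b); split => //.
  by rewrite theta_str -nk rmorphM.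
have thetaE h : theta h \in E.
  by apply/asboolP; exists 1, h; rewrite !rmorph1 mul1r oner_neq0.
have [g gE] := @subalg_corestr _ Hd E Ecl Estr H theta thetaE.
have g_str b : g (alg_str H b) = alg_str (restrAlg j (subalg Ecl Estr)) b.
  apply: (@subalg_val_inj _ _ _ Ecl Estr).
  by rewrite gE theta_str -(algHom_str (subalg_val Ecl Estr)).
pose y : M (restrAlg j (subalg Ecl Estr)) :=
  gf_map M (@AlgHom B H (restrAlg j (subalg Ecl Estr)) g g_str) v.
move=> x; suff: x \in E by move/asboolP.
apply: (represents_subalg_full udP).
apply: (iP_descent (y := y)); first exact: subalg_val_inj.
rewrite -thetaP /y /= -gf_comp; congr (gf_map M _ v).
by apply: algHom_eq => h; exact: gE.
Qed.

(** Every function on M that is pulled back along iQ is, up to a denominator, a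
function pulled back along iP; evaluate this identity at the points of D. *)
Lemma commensurable_points (iQ : gfHom D (baseChange j M)) (h : H) :
  exists (n : B) (h' : H), j n != 0 /\
    forall (A : alg K) (d : D A) (a b : algHom H (restrAlg j A)),
      gf_map M a v = iP A d -> gf_map M b v = iQ A d ->
      alg_str A (j n) * b h = a h'.
Proof.
have [tP [tPE _]] := vP (iP Hd ud : M (restrAlg j Hd)).
have [tQ [tQE _]] := vP (iQ Hd ud : M (restrAlg j Hd)).
have [n [h' [n0 nh]]] := commensurable_coordinates tPE (tQ h).
exists n, h'; split=> // A d a b aP bQ.
have [e [eud _]] := udP d.
have aE : a = compHom (restrHom j e) tP.
  by apply: (represents_inj vP); rewrite gf_comp tPE aP -eud (gfHom_nat iP).
have bE : b = compHom (restrHom j e) tQ.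
  by apply: (represents_inj vP); rewrite gf_comp tQE bQ -eud (gfHom_nat iQ).
by rewrite aE bE /= -nh rmorphM algHom_str.
Qed.

End Commensurable.

(** * Reduction of points *)

Section Reduction.
Variables (K : fieldExtType rat) (S : set (primeOf K)).
Local Notation OK := (ringOfIntegers K).
Local Notation B := (sIntegers S).

Lemma ringOfIntegers_sIntegers (a : OK) : val a \in sIntegers_pred S.
Proof.
apply/asboolP => p _; apply/asboolP; exists a, 1.
by rewrite prime_notin1 rmorph1 divr1.
Qed.

Lemma sIntegers_frac (k : K) :
  exists b n : B, sIntegers_inj S n != 0 /\ sIntegers_inj S n * k = sIntegers_inj S b.
Proof.
have [b b0 bk] := integral_int_multiple k.
have bkO : b%:~R * k \in @ringOfIntegers_pred K by exact/asboolP.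
exists (Sub (b%:~R * k) (ringOfIntegers_sIntegers (Sub (b%:~R * k) bkO : OK))).
by exists b%:~R; rewrite rmorph_int intK_eq0.
Qed.

Variables (p : primeOf K) (Sp : ~ S p).

Lemma extend_localAlg (H : alg B) (s : seq H) (a : algHom H (fracAlg S)) :
    generates s ->
    (forall h, h \in s -> (a h : K) \in localRing_pred p) ->
  exists a' : algHom H (localAlg Sp), compHom (localToFrac Sp) a' = a.
Proof.
move=> sP sl.
have al h : (a h : K) \in localRing_pred p.
  have [l1 lB lM] := localRing_closed p.
  apply: (sP (fun h => (a h : K) \in localRing_pred p)) => [|b|k ks].
  - split=> [|x y xl yl|x y xl yl]; rewrite -topredE /= ?rmorph1 // ?rmorphB ?rmorphM.
    + exact: lB.
    + exact: lM.
  - rewrite -topredE /= algHom_str; exact: sIntegers_local_subproof.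
  - exact: sl.
pose f (h : H) : localRing p := Sub (a h : K) (al h).
have fB : zmod_morphism f by move=> x y; apply: val_inj; rewrite /= rmorphB.
have fM : monoid_morphism f.
  by split=> [|x y]; apply: val_inj; rewrite /= ?rmorph1 ?rmorphM.
have fs b : rmorphism_of fB fM (alg_str H b) = alg_str (localAlg Sp) b.
  by apply: val_inj; rewrite /= algHom_str.
exists (@AlgHom B H (localAlg Sp) (rmorphism_of fB fM) fs).
exact: algHom_eq.
Qed.

Definition good_reduction (M : groupFunctor B)
    (P Q : M (fracAlg S)) : Prop :=
  exists Pt Qt : M (localAlg Sp),
    [/\ gf_map M (localToFrac Sp) Pt = P, gf_map M (localToFrac Sp) Qt = Q &
      forall k, gf_map M (localToResidue Sp) Pt *+ k = 0 ->
        gf_map M (localToResidue Sp) Qt *+ k = 0].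

Lemma residue_cancel (n : B) (x y : localRing p) :
  sIntegers_inj S n != 0 -> (sIntegers_inj S n)^-1 \in localRing_pred p ->
  residue_pi p (sIntegers_local Sp n * x) =
    residue_pi p (sIntegers_local Sp n * y) ->
  residue_pi p x = residue_pi p y.
Proof.
move=> n0 nV; pose m : localRing p := Sub (sIntegers_inj S n)^-1 nV.
have mn : m * sIntegers_local Sp n = 1 by apply: val_inj; rewrite /= mulVf.
move=> /(congr1 ( *%R (residue_pi p m))).
by rewrite -!rmorphM !mulrA mn !mul1r.
Qed.

End Reduction.

(** Outside finitely many primes, P, Q and the inverses of the denominators n h of
[commensurable_points] are integral for all generators h. For such a prime, if
k P reduces to 0 then n h times the value of h at k Q agrees modulo the prime
with n h times its value at 0, and n h is invertible there. *)
Lemma finite_bad_reduction (K : fieldExtType rat) (S : set (primeOf K))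
    (M : groupFunctor (sIntegers S)) (D : groupFunctor K) (Hd : alg K) (ud : D Hd)
    (iP iQ : gfHom D (baseChange (sIntegers_inj S) M)) (R : D (selfAlg K)) :
    finite_set S -> affineFiniteType M -> represents ud ->
    (forall (A A' : alg K) (e : algHom A A')
        (y : baseChange (sIntegers_inj S) M A) (d' : D A'),
      injective e ->
      gf_map (baseChange (sIntegers_inj S) M) e y = iP A' d' ->
      exists d : D A, gf_map D e d = d') ->
  finite_set [set p : primeOf K |
    ~ exists Sp : ~ S p, good_reduction Sp (iP _ R) (iQ _ R)].
Proof.
move=> S_fin [H [v [vP [s sP]]]] udP iP_descent.
have [a [aE _]] := vP (fracAlg S) (iP (selfAlg K) R).
have [b [bE _]] := vP (fracAlg S) (iQ (selfAlg K) R).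
have comm h := commensurable_points (@sIntegers_frac K S) udP vP iP_descent iQ h.
pose n h := sval (cid (comm h)).
have nP h := svalP (cid (comm h)).
(* A bad prime for h: one where h is not integral at P or at Q, or where the
denominator n h is not invertible. *)
pose bad h : set (primeOf K) :=
  [set p | (a h : K) \notin localRing_pred p] `|`
  [set p | (b h : K) \notin localRing_pred p] `|`
  [set p | (sIntegers_inj S (n h))^-1 \notin localRing_pred p].
apply: (@sub_finite_set _ _ (S `|` \bigcup_(h in [set` s]) bad h)); last first.
  rewrite finite_setU; split=> //; apply: bigcup_finite => // h _.
  by rewrite !finite_setU; do ?split; exact: finite_nonintegral_primes.
move=> p not_good; apply: contrapT => not_bad; apply: not_good.
have Sp : ~ S p by move=> ?; apply: not_bad; left.
have good h : h \in s -> [/\ (a h : K) \in localRing_pred p,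
    (b h : K) \in localRing_pred p &
    (sIntegers_inj S (n h))^-1 \in localRing_pred p].
  move=> hs; split; apply: contraPT not_bad => hp; apply; right; exists h => //.
  - by left; left.
  - by left; right.
  - by right.
have [a' aa'] := extend_localAlg Sp sP (fun h hs => let: And3 x _ _ := good h hs in x).
have [b' bb'] := extend_localAlg Sp sP (fun h hs => let: And3 _ x _ := good h hs in x).
exists Sp, (gf_map M a' v), (gf_map M b' v).
split; [by rewrite -gf_comp aa'|by rewrite -gf_comp bb'|move=> k].
have [al [alE _]] := vP _ (gf_map M a' v *+ k).
have [be [beE _]] := vP _ (gf_map M b' v *+ k).
(* ep gives the values of functions at 0, which is both iP 0 and iQ 0. *)
have [ep [epE _]] := vP _ (0 : M (localAlg Sp)).
rewrite -!(raddfMn (gf_map M (localToResidue Sp))) -alE -beE -gf_comp => al0.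
have {al0} al0 : compHom (localToResidue Sp) al = compHom (localToResidue Sp) ep.
  by apply: (represents_inj vP); rewrite al0 gf_comp epE raddf0.
rewrite -gf_comp; transitivity (gf_map M (compHom (localToResidue Sp) ep) v);
  last by rewrite gf_comp epE raddf0.
apply: (represents_finite_eq vP sP) => h hs.
have [_ _ nV] := good h hs.
have [h' [n0 nh]] := nP h.
apply: (residue_cancel (Sp := Sp) n0 nV).
have -> : sIntegers_local Sp (n h) * be h = al h'.
  apply: val_inj; rewrite rmorphM.
  apply: (nh _ (R *+ k) (compHom (localToFrac Sp) al) (compHom (localToFrac Sp) be)).
    by rewrite gf_comp alE raddfMn /= -gf_comp aa' aE raddfMn.
  by rewrite gf_comp beE raddfMn /= -gf_comp bb' bE raddfMn.
have -> : sIntegers_local Sp (n h) * ep h = ep h'.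
  apply: val_inj; rewrite rmorphM.
  apply: (nh _ 0 (compHom (localToFrac Sp) ep) (compHom (localToFrac Sp) ep)).
    by rewrite gf_comp epE !raddf0.
  by rewrite gf_comp epE !raddf0.
exact: (congr1 (fun f : algHom _ _ => f h') al0).
Qed.

(** * Orders and exponents *)

Lemma isOrder_exists (V : zmodType) (x : V) : exists n, isOrder x n.
Proof.
have [[n n_gt0]|no_n] := pselect (exists2 n, (0 < n)%N & x *+ n == 0); last first.
  exists 0%N => k; rewrite dvd0n; split=> [xk|/eqP-> //].
  by apply: contra_notT no_n; rewrite -lt0n => k_gt0; exists k => //; apply/eqP.
move=> xn.
have exn : exists n, (0 < n)%N && (x *+ n == 0) by exists n; rewrite n_gt0.
case: (ex_minnP exn) => m /andP[m_gt0 /eqP xm] m_min {n n_gt0 xn exn}.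
exists m => k; split=> [xk|/dvdnP[q ->]]; last by rewrite mulnC mulrnA xm mul0rn.
rewrite /dvdn; apply: contraT; rewrite -lt0n => r_gt0.
have /m_min : (0 < k %% m)%N && (x *+ (k %% m) == 0).
  rewrite r_gt0; move: xk; rewrite {1}(divn_eq k m) mulrnDr mulnC mulrnA xm.
  by rewrite mul0rn add0r => ->; rewrite eqxx.
by rewrite leqNgt ltn_mod m_gt0.
Qed.

Lemma isExponent_dvd (V : zmodType) (W : {pred V}) (c : nat) :
    (0 < c)%N -> {in W, forall x : V, x *+ c = 0} ->
  exists e, isExponent W e /\ (e %| c)%N.
Proof.
move=> c0 cW; pose kills n := `[< (0 < n)%N /\ {in W, forall x : V, x *+ n = 0} >].
have exK : exists n, kills n by exists c; apply/asboolP.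
case: (ex_minnP exK) => e /asboolP[e0 eW] e_min.
exists e; split; first by split=> // k k0 kW; apply/e_min/asboolP.
rewrite /dvdn; apply: contraT; rewrite -lt0n => r0.
have /e_min : kills (c %% e)%N.
  apply/asboolP; split=> // x xW.
  have := cW x xW; rewrite {1}(divn_eq c e) mulrnDr mulnC mulrnA eW // mul0rn.
  by rewrite add0r.
by rewrite leqNgt ltn_mod e0.
Qed.

(** * Application to T * Td *)

Section TorusProduct.
Variables (K : fieldExtType rat) (T : groupFunctor K) (Td : subGF T).
Variable R : subFunctor Td (selfAlg K).
Local Notation G := (prodGF T Td).
Local Notation P := ((val R, 0) : G (selfAlg K)).
Local Notation Q := ((0, R) : G (selfAlg K)).

(** The two immersions d |-> (d, 0) and d |-> (0, d) of Td satisfy the hypotheses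
of [finite_bad_reduction]: a point of T that lands in Td after an injective
extension of scalars is a point of the closed subgroup Td. *)
Lemma finite_order_not_dvd (S : set (primeOf K)) (M : model S G) :
    closedSub Td -> affineFiniteType Td -> finite_set S ->
  finite_set [set p : primeOf K | ~ orderModDvd M Q P p].
Proof.
move=> Td_closed [Hd [ud [udP _]]] S_fin.
have [g [gK gK']] := gfIso_inverse (model_genericP M).
pose iP := comp_gfHom g (comp_gfHom (inl_gfHom T Td) (incl_gfHom Td)).
pose iQ := comp_gfHom g (inr_gfHom T Td).
have descent (A A' : alg K) (e : algHom A A')
    (y : baseChange (sIntegers_inj S) M A) (d' : subFunctor Td A') :
    injective e ->
    gf_map (baseChange (sIntegers_inj S) M) e y = iP A' d' ->
    exists d : subFunctor Td A, gf_map Td e d = d'.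
  move=> e_inj yd'.
  have yT : gf_map T e (model_generic M A y).1 = val d'.
    have := congr1 (fun z => (model_generic M A' z).1) yd'.
    by rewrite gfHom_nat /= gK'.
  have yTd : (model_generic M A y).1 \in Td A.
    by apply: (closedSub_descent Td_closed e_inj); rewrite yT; exact: valP.
  exists (Sub (model_generic M A y).1 yTd : subPts Td A).
  exact: val_inj.
apply: sub_finite_set
  (finite_bad_reduction iQ R S_fin (model_affine M) udP descent).
move=> p /= not_dvd [Sp [Pt [Qt [PtE QtE PQ]]]]; apply: not_dvd.
have [m xm] := isOrder_exists (gf_map M (localToResidue Sp) Pt).
have [n yn] := isOrder_exists (gf_map M (localToResidue Sp) Qt).
exists Sp, (gf_map M (localToResidue Sp) Pt), (gf_map M (localToResidue Sp) Qt).
exists m, n; split=> //.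
- by exists Pt; rewrite PtE /= gK'.
- by exists Qt; rewrite QtE /= gK'.
- by apply/yn/PQ/xm.
Qed.

Lemma reached_kills_inter (Ta : subGF T) (phi : gfHom G G) (c : nat) :
    isAnisotropic Ta -> independent R -> phi (selfAlg K) P = Q *+ c ->
  forall (A : alg K) (x : T A), x \in interGF Ta Td A -> x *+ c = 0.
Proof.
move=> aniso indep phiP.
pose psi := comp_gfHom (snd_gfHom T Td) (comp_gfHom phi (inl_gfHom T Td)).
apply: (multiple_kills_inter (psi := psi) aniso indep).
by rewrite /psi /= phiP; elim: c {phiP} => // c IHc; rewrite !mulrS /= IHc.
Qed.

End TorusProduct.

Theorem mainTheorem7
  (K : fieldExtType rat)
  (Kbar : closedFieldType) (iota : {rmorphism K -> Kbar})
  (Kbar_closure : isAlgClosure iota)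
  (T : groupFunctor K) (T_torus : isTorus iota T)
  (Ta Td : subGF T)
  (Ta_max : isMaxAnisotropic iota Ta) (Td_max : isMaxSplit iota Td)
  (TaTd_nontrivial :
     exists (A : alg K) (x : T A), x \in interGF Ta Td A /\ x != 0)
  (R : subFunctor Td (selfAlg K)) (R_independent : independent R) :
  let G := prodGF T Td in
  let P : G (selfAlg K) := (val R, 0) in
  let Q : G (selfAlg K) := (0, R) in
  let multiple_reached (c : nat) :=
    exists phi : gfHom G G, phi (selfAlg K) P = Q *+ c in
  [/\ forall (S : set (primeOf K)) (M : model S G), finite_set S ->
        finite_set [set p : primeOf K | ~ orderModDvd M Q P p],
      forall c : nat, isMinPos multiple_reached c ->
        (exists e : nat,
           isExponent (interGF Ta Td (Alg iota)) e /\ (e %| c)%N) /\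
        c <> 1%N
    & ~ exists phi : gfHom G G, phi (selfAlg K) P = Q].
Proof.
move=> G P Q multiple_reached.
have [[_ Ta_aniso] _] := Ta_max.
have [[[Td_closed [Td_affine _]] _] _] := Td_max.
have not_reached1 : ~ multiple_reached 1%N.
  move=> [phi phiP]; have [A [x [xI /eqP]]] := TaTd_nontrivial; apply.
  exact: (reached_kills_inter Ta_aniso R_independent phiP xI).
split.
- by move=> S M; exact: finite_order_not_dvd.
- move=> c [c_gt0 c_reached _]; split; last first.
    by move=> c1; apply: not_reached1; rewrite -c1.
  apply: isExponent_dvd => // x xI; have [phi phiP] := c_reached.
  exact: (reached_kills_inter Ta_aniso R_independent phiP xI).
- by move=> [phi phiP]; apply: not_reached1; exists phi.
Qed.
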